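(* Let $A=(a_{ij})_{i,j\in I}$ be a generalized Cartan matrix with Kac–Moody algebra $\mathfrak{g}=\mathfrak{g}(A)$ and Weyl group $W$. Let $\Lambda\in P^+$ be a dominant integral weight and $K\in Z^+$. Let $U=U_{\Gamma_s(\Lambda)}$ and $D=D_{\Gamma_w(K)}$. Then $$DU-UD=\langle K,\Lambda\rangle\,\mathrm{Id}$$ as $\mathbb{Z}$-linear operators on $\mathbb{Z}W$; that is, $(\Gamma_s(\Lambda),\Gamma_w(K))$ is a pair of dual graded graphs with differential coefficient $r=\langle K,\Lambda\rangle$.
   Context: Let $\mathfrak{h}\subset\mathfrak{g}$ be the Cartan subalgebra (realization of minimal dimension, simple roots linearly independent), $\{\alpha_i\}\subset\mathfrak{h}^*$ the simple roots, $\{\alpha_i^\vee\}\subset\mathfrak{h}$ the simple coroots, $\{\Lambda_i\}$ the fundamental weights, $\langle\cdot,\cdot\rangle:\mathfrak{h}\times\mathfrak{h}^*\to\mathbb{C}$ the natural pairing with $a_{ij}=\langle\alpha_i^\vee,\alpha_j\rangle$. $W$ is generated by the simple reflections $s_i$; $\ell$ is the length function; $\Delta_{re}^+$ is the set of positive real roots; for $\alpha=u\alpha_i$ ($u\in W$) put $\alpha^\vee=u\alpha_i^\vee$ and $s_\alpha=us_iu^{-1}$. The strong (Bruhat) order has covers $w\lessdot ws_\alpha$ whenever $\alpha\in\Delta_{re}^+$ and $\ell(ws_\alpha)=\ell(w)+1$; the left weak order has covers $w\prec s_iw$ whenever $\ell(s_iw)=\ell(w)+1$. $P^+$ is the set of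 dominant integral weights. $Z^+=Z(\mathfrak{g})\cap\bigoplus_{i\in I}\mathbb{Z}_{\ge0}\alpha_i^\vee$, where $Z(\mathfrak{g})$ is the center; write $K=\sum_i k_i\alpha_i^\vee$. A graded graph is a set $V$ with a grading $h:V\to\mathbb{Z}_{\ge0}$ and directed edges $(v,w)$ with $h(w)=h(v)+1$ carrying multiplicities $m(v,w)\in\mathbb{Z}_{\ge0}$; its up and down operators on the free abelian group $\mathbb{Z}V$ are $U(v)=\sum_{(v,w)}m(v,w)w$ and $D(w)=\sum_{(v,w)}m(v,w)v$. Two graded graphs $\Gamma,\Gamma'$ on the same graded vertex set are called dual with differential coefficient $r$ if $D_{\Gamma'}U_\Gamma-U_\Gamma D_{\Gamma'}=r\,\mathrm{Id}$. $\Gamma_s(\Lambda)$ is the graded graph with vertex set $W$, grading $\ell$, and an edge $(v,w)$ for each strong cover $v\lessdot w=vs_\alpha$, of multiplicity $\langle\alpha^\vee,\Lambda\rangle$. $\Gamma_w(K)$ is the graded graph with vertex set $W$, grading $\ell$, and an edge $(v,s_iv)$ for each left weak cover $v\prec s_iv$, of multiplicity $k_i=\langle K,\Lambda_i\rangle$. *)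

(* Defs.v *)
From HB Require Import structures.
From mathcomp Require Import all_boot all_order all_algebra.
From mathcomp Require Import boolp classical_sets cardinality fsbigop reals.
From mathcomp Require Import complex freeg.

Set Implicit Arguments.
Unset Strict Implicit.
Unset Printing Implicit Defensive.

Import Order.TTheory GRing.Theory Num.Theory.

Local Open Scope ring_scope.
Local Open Scope classical_set_scope.

Section GradedGraph.

(* [mult v w] is the total multiplicity of the edges from v to w. *)
Record graded_graph (V : choiceType) (h : V -> nat) := GradedGraph {
  mult : V -> V -> nat;
  mult_graded : forall v w, mult v w <> 0%N -> h w = (h v).+1 }.

Variables (V : choiceType) (h : V -> nat).

(* The sums over V are finitely supported sums: they are 0 by convention when
   infinitely many multiplicities are nonzero. *)
Definition up (G : graded_graph h) : {freeg V} -> {freeg V} :=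
  fglift (fun v => \sum_(w \in [set: V]) (<< w >> : {freeg V}) *+ mult G v w).

Definition down (G : graded_graph h) : {freeg V} -> {freeg V} :=
  fglift (fun w => \sum_(v \in [set: V]) (<< v >> : {freeg V}) *+ mult G v w).

Definition dual_graded_graphs (G G' : graded_graph h) (r : int) :=
  forall x : {freeg V}, down G' (up G x) - up G (down G' x) = r *: x.

End GradedGraph.

Section LieAlgebra.
Variable F : fieldType.

Record lie_algebra := LieAlgebra {
  lie_sort :> lmodType F;
  bracket : lie_sort -> lie_sort -> lie_sort;
  bracket_linearl : forall y, linear (bracket^~ y);
  bracket_linearr : forall x, linear (bracket x);
  bracketxx : forall x, bracket x x = 0;
  jacobi : forall x y z,
    bracket x (bracket y z) + bracket y (bracket z x)
      + bracket z (bracket x y) = 0 }.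

Variable g : lie_algebra.

Definition subspace (S : set g) :=
  S 0 /\ forall (a : F) x y, S x -> S y -> S (a *: x + y).

Definition lie_subalgebra (S : set g) :=
  subspace S /\ forall x y, S x -> S y -> S (bracket x y).

Definition lie_ideal (J : set g) :=
  subspace J /\ forall x y, J y -> J (bracket x y).

Definition lie_center : set g := [set x | forall y, bracket x y = 0].

End LieAlgebra.

Record gen_cartan_matrix (I : finType) := GenCartanMatrix {
  gcm :> I -> I -> int;
  gcm_diag : forall i, gcm i i = 2;
  gcm_le0 : forall i j, i != j -> gcm i j <= 0;
  gcm_eq0 : forall i j, gcm i j = 0 -> gcm j i = 0 }.

(* A realization in the sense of Kac: it has the minimal dimension
   2 #|I| - rank A allowed by the two linear independence conditions. *)
Record realization (R : realType) (I : finType) (A : gen_cartan_matrix I) :=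
  Realization {
  cartan : vectType R[i];
  simple_coroot : I -> cartan;
  simple_root : I -> 'Hom(cartan, R[i]^o);
  coroot_free : free [seq simple_coroot i | i : I];
  root_free : free [seq simple_root i | i : I];
  root_coroot : forall i j, simple_root j (simple_coroot i) = (A i j)%:~R;
  dim_cartan :
    (\dim {:cartan}
      + \rank (\matrix_(i < #|I|, j < #|I|)
                 ((A (enum_val i) (enum_val j))%:~R : R[i]))
     = #|I|.*2)%N }.

Section KacMoody.
Variables (R : realType) (I : finType) (A : gen_cartan_matrix I).
Variable rz : realization R A.

(* Kac's intrinsic description of g(A), which determines it up to isomorphism:
   h, the e_i and the f_i generate, they satisfy the relations below, and no
   nonzero ideal meets h trivially. *)
Record kac_moody_algebra := KacMoodyAlgebra {
  km_lie :> lie_algebra R[i];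
  km_h : {linear cartan rz -> km_lie};
  km_e : I -> km_lie;
  km_f : I -> km_lie;
  km_h_inj : injective km_h;
  km_hh : forall x y, bracket (km_h x) (km_h y) = 0;
  km_he : forall x i, bracket (km_h x) (km_e i) = simple_root rz i x *: km_e i;
  km_hf : forall x i, bracket (km_h x) (km_f i) = - simple_root rz i x *: km_f i;
  km_ef : forall i j, bracket (km_e i) (km_f j) =
    if i == j then km_h (simple_coroot rz i) else 0;
  km_gen : forall S : set km_lie, lie_subalgebra S ->
    (forall x, S (km_h x)) -> (forall i, S (km_e i)) ->
    (forall i, S (km_f i)) -> forall x, S x;
  km_ideal : forall J : set km_lie, lie_ideal J ->
    (forall x, J (km_h x) -> x = 0) -> forall x, J x -> x = 0 }.

(* Z^+, as a subset of h. *)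
Definition positive_center (g : kac_moody_algebra) : set (cartan rz) :=
  [set K | lie_center (km_h g K) /\
           exists k : I -> nat, K = \sum_i simple_coroot rz i *+ k i].

Definition pairing (x : cartan rz) (lam : 'Hom(cartan rz, R[i]^o)) : R[i] :=
  lam x.

Definition dominant_integral (lam : 'Hom(cartan rz, R[i]^o)) :=
  forall i, exists n : nat, pairing (simple_coroot rz i) lam = n%:R.

Definition fundamental_weights (varpi : I -> 'Hom(cartan rz, R[i]^o)) :=
  forall i j, pairing (simple_coroot rz i) (varpi j) = (i == j)%:R.

Definition simple_refl (i : I) : 'End(cartan rz) :=
  linfun (fun x : cartan rz => x - pairing x (simple_root rz i) *: simple_coroot rz i).

Lemma simple_reflE i x :
  simple_refl i x = x - pairing x (simple_root rz i) *: simple_coroot rz i.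
Proof.
pose f x := x - pairing x (simple_root rz i) *: simple_coroot rz i.
have fl : linear f.
  move=> a u v; rewrite /f /pairing linearP /= scalerDl -scalerA.
  by rewrite scalerBr opprD addrACA.
pose fL := GRing.isLinear.Build _ _ _ _ f fl.
pose F : {linear cartan rz -> cartan rz} := HB.pack f fL.
exact: (lfunE F).
Qed.

Definition word (s : seq I) : 'End(cartan rz) :=
  foldr (fun i u => simple_refl i \o u)%VF \1%VF s.

(* W as a subgroup of GL(h). The simple reflections are involutions, so the
   group they generate consists of the products of simple reflections. *)
Definition weyl_pred : pred 'End(cartan rz) :=
  fun u => `[< exists s, u = word s >].

Record weyl := Weyl { weyl_val :> 'End(cartan rz); _ : weyl_pred weyl_val }.

HB.instance Definition _ := [isSub for weyl_val].
HB.instance Definition _ := [Choice of weyl by <:].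


Lemma simple_reflK i : (simple_refl i \o simple_refl i)%VF = \1%VF.
Proof.
apply/lfunP => x; rewrite comp_lfunE id_lfunE !simple_reflE /pairing.
set c := simple_coroot rz i; set a := simple_root rz i x.
have -> : simple_root rz i (x - a *: c) = - a.
  have -> : simple_root rz i (x - a *: c) = a - a * simple_root rz i c.
    by rewrite linearB /= linearZ.
  by rewrite root_coroot gcm_diag mulrDr mulr1 opprD addNKr.
by rewrite scaleNr opprK subrK.
Qed.

Lemma word_cat s t : word (s ++ t) = (word s \o word t)%VF.
Proof.
elim: s => [|i s IH] /=; first by rewrite comp_lfun1l.
by rewrite IH comp_lfunA.
Qed.

Lemma word_revK s : (word (rev s) \o word s)%VF = \1%VF.
Proof.
elim: s => [|i s IH]; first by rewrite comp_lfun1l.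
rewrite rev_cons -cats1 word_cat /= comp_lfun1r -comp_lfunA.
by rewrite (comp_lfunA (simple_refl i)) simple_reflK comp_lfun1l.
Qed.

Lemma word_lker0 s : lker (word s) == 0%VS.
Proof.
apply/lker0P => x y e; have := congr1 (word (rev s)) e.
by rewrite -!comp_lfunE word_revK !id_lfunE.
Qed.

Lemma word_rev s : word (rev s) = (word s)^-1%VF.
Proof.
by rewrite -[LHS]comp_lfun1r -(lker0_compfV (word_lker0 s)) comp_lfunA
  word_revK comp_lfun1l.
Qed.

Lemma weylP (w : weyl) : exists s, weyl_val w = word s.
Proof. by case: w => w /= /asboolP. Qed.

Lemma weyl_one_subproof : weyl_pred \1%VF.
Proof. by apply/asboolP; exists [::]. Qed.

Lemma weyl_mul_subproof (u v : weyl) : weyl_pred (u \o v)%VF.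
Proof.
have [[s ->] [t ->]] := (weylP u, weylP v).
by apply/asboolP; exists (s ++ t); rewrite word_cat.
Qed.

Lemma weyl_inv_subproof (u : weyl) : weyl_pred (u^-1)%VF.
Proof.
by have [s ->] := weylP u; apply/asboolP; exists (rev s); rewrite word_rev.
Qed.

Lemma weyl_s_subproof i : weyl_pred (simple_refl i).
Proof. by apply/asboolP; exists [:: i]; rewrite /= comp_lfun1r. Qed.

Definition weyl_one := Weyl weyl_one_subproof.
Definition weyl_mul u v := Weyl (weyl_mul_subproof u v).
Definition weyl_inv u := Weyl (weyl_inv_subproof u).
Definition weyl_s i := Weyl (weyl_s_subproof i).

Lemma weyl_mulA : associative weyl_mul.
Proof. by move=> u v w; apply/val_inj; rewrite /= comp_lfunA. Qed.

Lemma weyl_mul1 : left_id weyl_one weyl_mul.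
Proof. by move=> u; apply/val_inj; rewrite /= comp_lfun1l. Qed.

Lemma weyl_mulr1 : right_id weyl_one weyl_mul.
Proof. by move=> u; apply/val_inj; rewrite /= comp_lfun1r. Qed.

Lemma weyl_mulV : left_inverse weyl_one weyl_inv weyl_mul.
Proof.
move=> u; apply/val_inj => /=; have [s ->] := weylP u.
by rewrite lker0_compVf ?word_lker0.
Qed.

Lemma weyl_mulrV : right_inverse weyl_one weyl_inv weyl_mul.
Proof.
move=> u; apply/val_inj => /=; have [s ->] := weylP u.
by rewrite lker0_compfV ?word_lker0.
Qed.

HB.instance Definition _ := isGroup.Build weyl
  weyl_mulA weyl_mul1 weyl_mulr1 weyl_mulV weyl_mulrV.

Lemma weyl_length_subproof (w : weyl) :
  exists n, `[< exists2 s, size s = n & weyl_val w = word s >].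
Proof. by have [s ws] := weylP w; exists (size s); apply/asboolP; exists s. Qed.

Definition weyl_length (w : weyl) : nat := ex_minn (weyl_length_subproof w).

(* The contragredient action of W on h^*. *)
Definition weyl_dual (w : weyl) (lam : 'Hom(cartan rz, R[i]^o)) :
    'Hom(cartan rz, R[i]^o) := (lam \o w^-1)%VF.

Definition real_root (al : 'Hom(cartan rz, R[i]^o)) :=
  exists (u : weyl) (i : I), al = weyl_dual u (simple_root rz i).

Definition positive_real_root (al : 'Hom(cartan rz, R[i]^o)) :=
  real_root al /\ exists n : I -> nat, al = \sum_i simple_root rz i *+ n i.

(* al^vee and s_al do not depend on the choice of (u, i) with al = u alpha_i,
   so the sets below are singletons when al is a real root. *)
Definition coroot (al : 'Hom(cartan rz, R[i]^o)) : cartan rz :=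
  xget 0 [set c | exists (u : weyl) (i : I),
    al = weyl_dual u (simple_root rz i) /\ c = u (simple_coroot rz i)].

Definition reflection (al : 'Hom(cartan rz, R[i]^o)) : weyl :=
  xget 1%g [set s | exists (u : weyl) (i : I),
    al = weyl_dual u (simple_root rz i) /\ s = (u * weyl_s i * u^-1)%g].

(* v < v s_al in the strong order *)
Definition strong_cover (v : weyl) (al : 'Hom(cartan rz, R[i]^o)) :=
  positive_real_root al /\ weyl_length (v * reflection al)%g = (weyl_length v).+1.

Definition weak_cover (v : weyl) (i : I) : bool :=
  weyl_length (weyl_s i * v)%g == (weyl_length v).+1.

(* The natural number equal to z, if there is one. *)
Definition nat_of_complex (z : R[i]) : nat := xget 0%N [set n : nat | z = n%:R].

Lemma nat_of_complexE (n : nat) : nat_of_complex n%:R = n.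
Proof.
apply: xget_unique => //= m /eqP; rewrite eqr_nat => /eqP; exact: esym.
Qed.

Lemma fundamental_weights_coord varpi (k : I -> nat) i :
  fundamental_weights varpi ->
  nat_of_complex (pairing (\sum_j simple_coroot rz j *+ k j) (varpi i)) = k i.
Proof.
move=> fw; rewrite /pairing linear_sum (bigD1 i) //= big1 => [|j ji].
  by rewrite addr0 raddfMn /= [fun_of_lfun _ _]fw eqxx nat_of_complexE.
by rewrite raddfMn /= [fun_of_lfun _ _]fw (negbTE ji) mul0rn.
Qed.

Definition strong_mult (Lam : 'Hom(cartan rz, R[i]^o)) (v w : weyl) : nat :=
  \big[addn/0%N]_(al \in [set al | strong_cover v al /\
                                    w = (v * reflection al)%g])
    nat_of_complex (pairing (coroot al) Lam).

Lemma strong_mult_graded Lam v w :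
  strong_mult Lam v w <> 0%N -> weyl_length w = (weyl_length v).+1.
Proof.
apply: contra_notP => lvw; rewrite /strong_mult fsbig1 // => al [[_ lv] wE].
by case: lvw; rewrite wE.
Qed.

Definition strong_graph Lam : graded_graph weyl_length :=
  GradedGraph (@strong_mult_graded Lam).

Definition weak_mult (varpi : I -> 'Hom(cartan rz, R[i]^o)) (K : cartan rz)
    (v w : weyl) : nat :=
  (\sum_(i | weak_cover v i && (w == weyl_s i * v)%g)
     nat_of_complex (pairing K (varpi i)))%N.

Lemma weak_mult_graded varpi K v w :
  weak_mult varpi K v w <> 0%N -> weyl_length w = (weyl_length v).+1.
Proof.
apply: contra_notP => lvw; rewrite /weak_mult big_pred0 // => i.
by apply/negP => /andP[/eqP lv /eqP wE]; case: lvw; rewrite wE.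
Qed.

Definition weak_graph varpi K : graded_graph weyl_length :=
  GradedGraph (@weak_mult_graded varpi K).

End KacMoody.

(* Main.v *)
(* W is a subgroup of GL(h), so its Coxeter theory has to be derived from the
   Cartan matrix. The basic fact is that l(w s_i) >= l(w) makes w alpha_i and
   w alpha_i^vee nonnegative combinations of simple (co)roots. It is proved by
   induction on l(w): split off from w a maximal right factor alternating in two
   simple reflections s_i, s_j, which reduces the claim to rank two. Hence real
   roots are positive or negative, alpha^vee and s_alpha are well defined, and
   the strong exchange property holds.

   Fix v and i. Exchange shows that if s_i v > v, then the only strong cover
   v s_alpha of v with s_i v s_alpha < v s_alpha is s_i v itself. It follows
   that the i-th part of (DU - UD) v is <v^-1 alpha_i^vee, Lambda> v: when
   s_i v > v this is the one term of DU, coming from alpha = v^-1 alpha_i, and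
   when s_i v < v it is the one uncancelled term of UD, coming from
   alpha = - v^-1 alpha_i. Summing with weights k_i gives <v^-1 K, Lambda> v,
   and W fixes the central element K. *)

From HB Require Import structures.
Require Import Defs.
From mathcomp Require Import all_boot all_order all_algebra finmap.
From mathcomp Require Import boolp classical_sets cardinality fsbigop reals.
From mathcomp Require Import complex freeg.
From mathcomp Require Import zify ring.

Set Implicit Arguments.
Unset Strict Implicit.
Unset Printing Implicit Defensive.

Import Order.TTheory GRing.Theory Num.Theory.

Local Open Scope ring_scope.

(** * Combinations with natural coefficients *)

Section NatSpan.
Variables (I : finType) (V : nmodType).

Definition nat_span (b : I -> V) : set V :=
  [set x | exists n : I -> nat, x = \sum_i b i *+ n i].

Lemma nat_spanD b x y : nat_span b x -> nat_span b y -> nat_span b (x + y).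
Proof.
move=> [n ->] [m ->]; exists (fun i => n i + m i)%N.
by rewrite -big_split; apply: eq_bigr => i _; rewrite mulrnDr.
Qed.

Lemma nat_spanMn b x k : nat_span b x -> nat_span b (x *+ k).
Proof.
move=> [n ->]; exists (fun i => n i * k)%N.
by rewrite -sumrMnl; apply: eq_bigr => i _; rewrite mulrnA.
Qed.

Lemma nat_span_gen b i : nat_span b (b i).
Proof.
exists (fun j => (j == i) : nat); rewrite (bigD1 i)//= eqxx big1 ?addr0// => j.
by move/negPf->.
Qed.

End NatSpan.

(** * Numerical recursions for rank two Cartan matrices *)

Section RankTwo.

(* The alternating word of length n in i and j that ends in j. *)
Fixpoint alt (I : Type) (i j : I) (n : nat) : seq I :=
  if n is m.+1 then (if odd m then i else j) :: alt i j m else [::].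

Lemma size_alt (I : Type) (i j : I) n : size (alt i j n) = n.
Proof. by elim: n => //= n ->. Qed.

Lemma alt_rcons (I : Type) (i j : I) n : alt j i n.+1 = rcons (alt i j n) i.
Proof.
by elim: n => // n IH; rewrite [LHS]/= -/(alt j i n.+1) IH /=; case: odd.
Qed.

Lemma alt_add (I : Type) (i j : I) m n :
  exists2 t, size t = m & alt i j (m + n) = t ++ alt i j n.
Proof.
elim: m => [|m [t <- IH]]; first by exists [::].
by rewrite addSn /= IH; eexists (_ :: t).
Qed.

(* The coordinates of w alpha_i in (alpha_i, alpha_j), where w is the product
   of [alt i j n], for the rank two Cartan matrix with off-diagonal entries
   -a = a_ij and -b = a_ji. *)
Fixpoint alt_coord (a b : int) (n : nat) : int * int :=
  if n is m.+1 then
    let: (x, y) := alt_coord a b m in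
    if odd m then (a * y - x, y) else (x, b * x - y)
  else (1, 0).

Definition alt_coord_ge0 a b n :=
  (0 <= (alt_coord a b n).1) && (0 <= (alt_coord a b n).2).

Lemma alt_coord_infinite a b n :
  0 <= a -> 0 <= b -> 4 <= a * b -> alt_coord_ge0 a b n.
Proof.
move=> a0 b0 ab; rewrite /alt_coord_ge0.
(* The last clause says that the coordinate replaced by the next letter does not drop below its old
   value. It propagates because a * b is at least 4. *)
suff: let: (x, y) := alt_coord a b n in
  [/\ 0 <= x, 0 <= y & if odd n then 2 * x <= a * y else 2 * y <= b * x].
  by case: alt_coord => x y [-> ->].
elim: n => [|n]; first by split=> //=; lia.
rewrite /=; case: alt_coord => x y; case: odd => /= -[x0 y0 h]; split=> /=; nia.
Qed.

(* The coefficients of alpha_i^vee and alpha_j^vee in w x - x, where w is the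
   product of [alt i j n], p = alpha_i(x) and q = alpha_j(x). *)
Fixpoint alt_disp (K : pzRingType) (a b p q : K) (n : nat) : K * K :=
  if n is m.+1 then
    let: (x, y) := alt_disp a b p q m in
    if odd m then (b * y - x - p, y) else (x, a * x - y - q)
  else (0, 0).

(* Types A1 x A1, A2, B2 and G2; [m.+1] is the order of s_i s_j, and the last
   conclusion is the braid relation. *)
Lemma alt_finite (K : comPzRingType) (a b : int) :
    0 <= a -> 0 <= b -> (a = 0 -> b = 0) -> (b = 0 -> a = 0) -> a * b < 4 ->
  exists2 m,
    forall n, (n <= m)%N -> alt_coord_ge0 a b n && alt_coord_ge0 b a n
  & forall p q : K,
      let: (x, y) := alt_disp a%:~R b%:~R p q m.+1 in
      alt_disp b%:~R a%:~R q p m.+1 = (y, x).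
Proof.
move=> a0 b0 ab0 ba0 ab.
have : (a, b) \in [:: (0, 0); (1, 1); (1, 2); (2, 1); (1, 3); (3, 1)].
  have a4 : a < 4 by have [/ba0|] := eqVneq b 0; nia.
  rewrite !inE !xpair_eqE.
  have : [|| a == 0, a == 1, a == 2 | a == 3] by lia.
  by case/or4P => /eqP aE; subst a; lia.
rewrite !inE; case/or4P => [|||/or3P[]] /eqP[-> ->];
  [exists 1%N|exists 2%N|exists 3%N|exists 3%N|exists 5%N|exists 5%N].
all: try by do 6?[case=> //].
all: by move=> p q /=; congr pair; ring.
Qed.

End RankTwo.

(** * Reduction of duality to basis elements *)

Section GradedGraphAdditive.
Variables (V : choiceType) (h : V -> nat).
Implicit Types G : graded_graph h.

Lemma up_is_additive G : additive (Defs.up G).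
Proof. exact: lift_is_additive. Qed.

Lemma down_is_additive G : additive (Defs.down G).
Proof. exact: lift_is_additive. Qed.

HB.instance Definition _ G :=
  GRing.isZmodMorphism.Build {freeg V} {freeg V} (Defs.up G) (up_is_additive G).
HB.instance Definition _ G :=
  GRing.isZmodMorphism.Build {freeg V} {freeg V} (Defs.down G) (down_is_additive G).

Lemma upU G v :
  Defs.up G << v >> = \sum_(w \in [set: V]) (<< w >> : {freeg V}) *+ mult G v w.
Proof. by rewrite /Defs.up liftU scale1r. Qed.

Lemma downU G w :
  Defs.down G << w >> = \sum_(v \in [set: V]) (<< v >> : {freeg V}) *+ mult G v w.
Proof. by rewrite /Defs.down liftU scale1r. Qed.

Lemma dual_graded_graphsU G G' (r : int) :
  (forall v, Defs.down G' (Defs.up G << v >>) - Defs.up G (Defs.down G' << v >>)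
             = << v >> *~ r) ->
  dual_graded_graphs G G' r.
Proof.
move=> dualU x; have -> : r *: x = x *~ r by rewrite -scaler_int intz.
rewrite -(freeg_sumE x) !raddf_sum -big_split.
rewrite mulrz_suml; apply: eq_bigr => z _ /=; set c := coeff z x.
have -> : << c *g z >> = << z >> *~ c :> {freeg V} by rewrite freegU_mulz intz.
by rewrite !raddfMz /= -mulrzDl dualU -!mulrzA mulrC.
Qed.

End GradedGraphAdditive.

Section Weyl.
Local Open Scope classical_set_scope.
Variables (R : realType) (I : finType) (A : gen_cartan_matrix I).
Variable rz : realization R A.

Local Notation W := (weyl rz).
Local Notation H := (cartan rz).
Local Notation H' := 'Hom(H, R[i]^o).
Local Notation rt := (simple_root rz).
Local Notation crt := (simple_coroot rz).
Local Notation s := (weyl_s rz).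
Local Notation len := (@weyl_length R I A rz).
Local Notation "w *^ lam" := (weyl_dual w lam) (at level 30).
Local Notation pos := (nat_span rt).
Local Notation wt_mult Lam al := (nat_of_complex (pairing (coroot al) Lam)).

(** * Words and lengths in W *)

Definition wprod (t : seq I) : W := foldr (fun i u => s i * u)%g 1%g t.

Lemma wprod_val t : weyl_val (wprod t) = word rz t.
Proof. by elim: t => //= i t <-. Qed.

Lemma wprod_cat t1 t2 : wprod (t1 ++ t2) = (wprod t1 * wprod t2)%g.
Proof. by elim: t1 => [|i t IH] /=; rewrite ?mul1g// IH mulgA. Qed.

Lemma wprod_rcons t i : wprod (rcons t i) = (wprod t * s i)%g.
Proof. by rewrite -cats1 wprod_cat /= mulg1. Qed.

Lemma weyl_sK i : (s i * s i = 1)%g.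
Proof. by apply/val_inj; exact: simple_reflK. Qed.

Lemma weyl_sV i : ((s i)^-1 = s i)%g.
Proof. by apply: mulg1_eq; exact: weyl_sK. Qed.

Lemma weyl_mulsK w i : (w * s i * s i = w)%g.
Proof. by rewrite -mulgA weyl_sK mulg1. Qed.

Lemma weyl_smulK w i : (s i * (s i * w) = w)%g.
Proof. by rewrite mulgA weyl_sK mul1g. Qed.

Lemma wprod_rev t : wprod (rev t) = ((wprod t)^-1)%g.
Proof.
elim: t => [|i t IH]; first by rewrite /= invg1.
by rewrite rev_cons wprod_rcons IH /= invgM weyl_sV.
Qed.

Lemma reduced_word w : exists2 t, size t = len w & w = wprod t.
Proof.
rewrite /weyl_length; case: ex_minnP => n /asboolP[t <- wt] _; exists t => //.
by apply/val_inj; rewrite /= wprod_val.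
Qed.

Lemma len_wprod t : (len (wprod t) <= size t)%N.
Proof.
rewrite /weyl_length; case: ex_minnP => n _; apply; apply/asboolP; exists t => //.
exact: wprod_val.
Qed.

Lemma len_eq0 w : len w = 0%N -> w = 1%g.
Proof. by have [t <- ->] := reduced_word w => /size0nil ->. Qed.

Lemma lenM u v : (len (u * v)%g <= len u + len v)%N.
Proof.
have [[t1 <- {1}->] [t2 <- {1}->]] := (reduced_word u, reduced_word v).
by rewrite -wprod_cat -size_cat len_wprod.
Qed.

Lemma lenV_le w : (len (w^-1)%g <= len w)%N.
Proof.
by have [t <- {1}->] := reduced_word w; rewrite -wprod_rev -(size_rev t) len_wprod.
Qed.

Lemma lenV w : len (w^-1)%g = len w.
Proof. by apply/eqP; rewrite eqn_leq lenV_le -{1}(invgK w) lenV_le. Qed.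

Lemma len_s i : (len (s i) <= 1)%N.
Proof. by have := len_wprod [:: i]; rewrite /= mulg1. Qed.

Lemma len_mulsr w i : (len (w * s i)%g <= (len w).+1)%N.
Proof. by rewrite (leq_trans (lenM _ _))// -addn1 leq_add2l len_s. Qed.

Lemma len_mulsr_ge w i : (len w <= (len (w * s i)%g).+1)%N.
Proof. by rewrite -{1}(weyl_mulsK w i) len_mulsr. Qed.

(** * The actions of W on h and on its dual *)

Lemma weyl_valM (u v : W) x : ((u * v)%g : W) x = u (v x).
Proof. exact: comp_lfunE. Qed.

Lemma weyl_val1 x : (1%g : W) x = x.
Proof. exact: id_lfunE. Qed.

Lemma weyl_valK (w : W) x : ((w^-1)%g : W) (w x) = x.
Proof. by rewrite -weyl_valM mulVg weyl_val1. Qed.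

Lemma weyl_valKV (w : W) x : w (((w^-1)%g : W) x) = x.
Proof. by rewrite -weyl_valM mulgV weyl_val1. Qed.

Lemma weyl_inj (u v : W) : (forall x, u x = v x :> H) -> u = v.
Proof. by move=> uv; apply/val_inj/lfunP. Qed.

Lemma weyl_valB (w : W) x y : w (x - y) = w x - w y :> H.
Proof. exact: linearB. Qed.

Lemma weyl_valZ (w : W) (k : R[i]) x : w (k *: x) = k *: w x :> H.
Proof. exact: linearZ. Qed.

Lemma weyl_valN (w : W) x : w (- x) = - w x :> H.
Proof. exact: linearN. Qed.

Lemma weyl_sE i x : s i x = x - rt i x *: crt i.
Proof. exact: simple_reflE. Qed.

Lemma rt_crt i : rt i (crt i) = 2.
Proof. by rewrite root_coroot gcm_diag. Qed.

Lemma weyl_dualE (w : W) (lam : H') x : (w *^ lam) x = lam (((w^-1)%g : W) x).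
Proof. by rewrite comp_lfunE. Qed.

Lemma weyl_dualM (u v : W) (lam : H') : ((u * v)%g : W) *^ lam = u *^ (v *^ lam).
Proof.
rewrite /weyl_dual -[RHS]comp_lfunA; congr comp_lfun.
exact: (congr1 val (invgM u v)).
Qed.

Lemma weyl_dual1 (lam : H') : (1%g : W) *^ lam = lam.
Proof. by apply/lfunP => x; rewrite weyl_dualE invg1 weyl_val1. Qed.

Lemma weyl_dualK (w : W) (lam : H') : ((w^-1)%g : W) *^ (w *^ lam) = lam.
Proof. by rewrite -weyl_dualM mulVg weyl_dual1. Qed.

Lemma weyl_dualN (w : W) (lam : H') : w *^ (- lam) = - (w *^ lam).
Proof. exact: comp_lfunNl. Qed.

Lemma weyl_dualD (w : W) (lam mu : H') : w *^ (lam + mu) = w *^ lam + w *^ mu.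
Proof. exact: comp_lfunDl. Qed.

Lemma weyl_dualZ (w : W) (k : R[i]) (lam : H') : w *^ (k *: lam) = k *: (w *^ lam).
Proof. exact/esym/comp_lfunZl. Qed.

Lemma weyl_dualMn (w : W) (lam : H') n : w *^ (lam *+ n) = (w *^ lam) *+ n.
Proof.
elim: n => [|n IH]; first by rewrite !mulr0n; exact: comp_lfun0l.
by rewrite !mulrS weyl_dualD IH.
Qed.

Lemma lfun_subZE (lam mu : H') (k : R[i]) x :
  (lam - k *: mu) x = lam x - k * mu x.
Proof.
apply: etrans (add_lfunE _ _ _) _; congr (_ + _).
by apply: etrans (opp_lfunE _ _) _; congr (- _); exact: scale_lfunE.
Qed.

Lemma lfun_valBZ (lam : H') (k : R[i]) x y : lam (x - k *: y) = lam x - k * lam y.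
Proof. by rewrite linearB /= linearZ. Qed.

Lemma weyl_dual_s i (lam : H') : s i *^ lam = lam - lam (crt i) *: rt i.
Proof.
apply/lfunP => x.
by rewrite weyl_dualE weyl_sV weyl_sE lfun_valBZ lfun_subZE mulrC.
Qed.

Lemma weyl_dual_srt i : s i *^ rt i = - rt i.
Proof. by rewrite weyl_dual_s rt_crt scaler_nat opprD addNKr. Qed.

Lemma weyl_s_crt i : s i (crt i) = - crt i.
Proof. by rewrite weyl_sE rt_crt scaler_nat opprD addNKr. Qed.

Lemma root_indep (z : I -> R[i]) :
  \sum_i z i *: rt i = 0 -> forall i, z i = 0.
Proof.
move=> z0 i.
have sz : size [seq rt i | i : I] == #|I| by rewrite size_map -cardE.
have /freeP/(_ (fun k => z (enum_val k))) := root_free rz : free (Tuple sz).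
rewrite -(enum_rankK i); apply => {i}.
rewrite -[RHS]z0 [RHS](reindex (fun k : 'I_#|I| => enum_val k)); last first.
  by apply: onW_bij; exact: enum_val_bij.
apply: eq_bigr => k _; congr (_ *: _).
rewrite (nth_map (enum_val k)) -?cardE//.
by rewrite [in RHS](enum_val_nth (enum_val k)).
Qed.

(** * Alternating products of two simple reflections *)

Lemma weyl_dual_srtE i j : s i *^ rt j = rt j - rt i *~ A i j.
Proof. by rewrite weyl_dual_s root_coroot scaler_int. Qed.

Lemma weyl_s_crtE i j : s i (crt j) = crt j - crt i *~ A j i.
Proof. by rewrite weyl_sE root_coroot scaler_int. Qed.

Lemma weyl_dualMz (w : W) (lam : H') z : w *^ (lam *~ z) = (w *^ lam) *~ z.
Proof.
case: z => n; first exact: weyl_dualMn.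
by rewrite !NegzE !mulrNz weyl_dualN; congr (- _); exact: weyl_dualMn.
Qed.

Lemma weyl_valMz (w : W) x z : w (x *~ z) = w x *~ z.
Proof. exact: raddfMz. Qed.

Lemma weyl_valD (w : W) x y : w (x + y) = w x + w y.
Proof. exact: linearD. Qed.

Lemma weyl_dual_s2 i j (x y : int) :
  s i *^ (rt i *~ x + rt j *~ y) = rt i *~ (- A i j * y - x) + rt j *~ y.
Proof.
rewrite weyl_dualD !weyl_dualMz weyl_dual_srt weyl_dual_srtE.
rewrite mulrzBl -mulrzA mulNrz mulrzBr [(- A i j * y)%R]mulNr mulrNz.
by rewrite addrCA addrC [- _ - _]addrC.
Qed.

Lemma weyl_s_crt2 i j (x y : int) :
  s i (crt i *~ x + crt j *~ y) = crt i *~ (- A j i * y - x) + crt j *~ y.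
Proof.
rewrite weyl_valD !weyl_valMz weyl_s_crt weyl_s_crtE.
rewrite mulrzBl -mulrzA mulNrz mulrzBr [(- A j i * y)%R]mulNr mulrNz.
by rewrite addrCA addrC [- _ - _]addrC.
Qed.

Lemma alt_root i j n :
  let: (x, y) := alt_coord (- A i j) (- A j i) n in
  wprod (alt i j n) *^ rt i = rt i *~ x + rt j *~ y.
Proof.
elim: n => [|n] /=; first by rewrite weyl_dual1 mulr1z mulr0z addr0.
case: alt_coord => x y IH; case: odd; rewrite weyl_dualM IH.
  by rewrite weyl_dual_s2.
by rewrite addrC weyl_dual_s2 addrC.
Qed.

(** Coroots obey the transposed Cartan matrix, so the two off-diagonal entries trade places in
    [alt_coord]. *)
Lemma alt_coroot i j n :
  let: (x, y) := alt_coord (- A j i) (- A i j) n in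
  wprod (alt i j n) (crt i) = crt i *~ x + crt j *~ y.
Proof.
elim: n => [|n]; first by rewrite /= weyl_val1 mulr1z mulr0z addr0.
rewrite [alt_coord _ _ n.+1]/=; case: alt_coord => x y IH.
rewrite [wprod _]/=; case: odd; rewrite weyl_valM IH.
  by rewrite weyl_s_crt2.
by rewrite addrC weyl_s_crt2 addrC.
Qed.

Lemma rt_lin3 k x (y z : R[i]) i j :
  rt k (x + y *: crt i + z *: crt j) =
  rt k x + y * (A i k)%:~R + z * (A j k)%:~R.
Proof.
have D u v : rt k (u + v) = rt k u + rt k v by rewrite linearD.
have Z c u : rt k (c *: u) = c * rt k u by rewrite linearZ.
by rewrite !D !Z !root_coroot.
Qed.

Lemma alt_val i j n x :
  let: (y, z) := alt_disp (- A i j)%:~R (- A j i)%:~R (rt i x) (rt j x) n in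
  wprod (alt i j n) x = x + y *: crt i + z *: crt j.
Proof.
elim: n => [|n]; first by rewrite /= weyl_val1 !scale0r !addr0.
rewrite [alt_disp _ _ _ _ n.+1]/=; case: alt_disp => y z IH.
rewrite [wprod _]/=; case: odd; rewrite weyl_valM IH weyl_sE rt_lin3.
  rewrite addrAC -scaleNr -(addrA x) -scalerDl; congr (_ + _ *: _ + _).
  by rewrite gcm_diag !mulrNz; ring.
rewrite -addrA -scaleNr -scalerDl; congr (_ + _ *: _).
by rewrite gcm_diag !mulrNz; ring.
Qed.

(** By [alt_val] the displacement of any x in h depends only on [rt i x] and [rt j x], so an
    identity of displacements for all p and q is an identity in W. *)
Lemma alt_braid i j m :
    (forall p q : R[i],
      let: (x, y) := alt_disp (- A i j)%:~R (- A j i)%:~R p q m in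
      alt_disp (- A j i)%:~R (- A i j)%:~R q p m = (y, x)) ->
  wprod (alt i j m) = wprod (alt j i m).
Proof.
move=> h; apply: weyl_inj => x; have := alt_val i j m x; have := alt_val j i m x.
have := h (rt i x) (rt j x); case: alt_disp => y z -> -> ->.
by rewrite addrAC.
Qed.

(** If a * b is at least 4, every coordinate is nonnegative. Otherwise let m + 1 be the order of s_i
    s_j: up to m the coordinates are known, and beyond m the braid relation makes the word end in i,
    which cancels against [s i] and leaves n - 1 letters. *)
Lemma alt_root_or_shorter i j n : i != j ->
  (alt_coord_ge0 (- A i j) (- A j i) n && alt_coord_ge0 (- A j i) (- A i j) n)
  \/ (len (wprod (alt i j n) * s i)%g < n)%N.
Proof.
move=> ij; set a := - A i j; set b := - A j i.
have a0 : 0 <= a by rewrite oppr_ge0 gcm_le0.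
have b0 : 0 <= b by rewrite oppr_ge0 gcm_le0// eq_sym.
have [ab|ab] := lerP 4 (a * b).
  by left; rewrite !alt_coord_infinite// mulrC.
have [||m pos braid] := alt_finite R[i] a0 b0 _ _ ab.
- by move/eqP; rewrite oppr_eq0 => /eqP/gcm_eq0 e; rewrite /b e oppr0.
- by move/eqP; rewrite oppr_eq0 => /eqP/gcm_eq0 e; rewrite /a e oppr0.
have [nm|mn] := leqP n m; [by left; exact: pos | right].
have [t st tE] := alt_add i j (n - m.+1) m.+1.
rewrite subnK// in tE; rewrite tE wprod_cat (alt_braid braid) alt_rcons.
rewrite wprod_rcons mulgA weyl_mulsK -wprod_cat.
by rewrite (leq_ltn_trans (len_wprod _))// size_cat size_alt st; lia.
Qed.

(** * Positivity of real roots and coroots *)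

Definition pos_pair (lam : H') (x : H) := nat_span rt lam /\ nat_span crt x.

Lemma length_nondecr_pos w i :
  (len w <= len (w * s i)%g)%N -> pos_pair (w *^ rt i) (w (crt i)).
Proof.
have [n] := ubnP (len w); elim: n => // n IH in w i * => /ltnSE wn wi.
have [l0|lw] := posnP (len w).
  rewrite (len_eq0 l0) weyl_dual1 weyl_val1.
  by split; exact: nat_span_gen.
have [j jw] : exists j, (len (w * s j)%g < len w)%N.
  have [t st wt] := reduced_word w.
  case/lastP: t => [|t j] in st wt *; first by rewrite -st in lw.
  exists j; rewrite -st wt wprod_rcons weyl_mulsK size_rcons ltnS.
  exact: len_wprod.
have ij : i != j by apply/eqP => ij; rewrite ij in wi; lia.
(* [P k] says that the alternating product of length k splits off from w on the right with lengths
   adding up; the descent j gives k = 1. *)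
pose P k := (len (w * (wprod (alt i j k))^-1)%g + k == len w)%N.
have P1 : P 1%N.
  rewrite /P /= mulg1 weyl_sV; have := len_mulsr_ge w j; lia.
have Pb k : P k -> (k <= len w)%N by rewrite /P; lia.
have exP : exists k, P k by exists 1%N.
case: (ex_maxnP exP Pb) => k Pk kmax.
case: k => [|k] in Pk kmax *; first by have := kmax _ P1.
pose u := wprod (alt i j k.+1); pose v := (w * u^-1)%g.
have wvu : w = (v * u)%g by rewrite /v mulgVK.
have lvw : (len v + k.+1 = len w)%N by apply/eqP.
(* [p] is the first letter of [u], and [q] the letter that would prolong it on the left. A descent
   of v at p would make w too short, and one at q would contradict the maximality of k, so the
   induction hypothesis applies to v with both letters. *)
pose p := if odd k then i else j; pose q := if odd k then j else i.
have lvp : (len v <= len (v * s p)%g)%N.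
  have : (len w <= len (v * s p)%g + k)%N.
    have -> : w = (v * s p * wprod (alt i j k))%g.
      by rewrite -mulgA; exact: wvu.
    rewrite (leq_trans (lenM _ _))// leq_add2l.
    by have := len_wprod (alt i j k); rewrite size_alt.
  lia.
have lvq : (len v <= len (v * s q)%g)%N.
  rewrite leqNgt; apply/negP => lt.
  have /kmax : P k.+2; last by rewrite ltnn.
  have -> : P k.+2 = (len (v * s q)%g + k.+2 == len w)%N.
    rewrite /P [alt _ _ _]/= -/(alt i j k.+1) [wprod _]/= -/u invgM weyl_sV mulgA.
    by rewrite /q if_neg.
  by have := len_mulsr_ge v q; lia.
have vn : (len v < n)%N by lia.
have [vi vj] : pos_pair (v *^ rt i) (v (crt i)) /\ pos_pair (v *^ rt j) (v (crt j)).
  have := IH v p vn lvp; have := IH v q vn lvq.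
  by rewrite /p /q; case: odd.
have [/andP[/andP[x0 y0] /andP[x1 y1]]|lt] := alt_root_or_shorter k.+1 ij; last first.
  (* Shortening [u * s i] would make [w * s i] shorter than w, against [wi]. *)
  exfalso; have : (len (w * s i)%g < len v + k.+1)%N; last by lia.
  rewrite wvu -mulgA (leq_ltn_trans (lenM _ _))// ltn_add2l; exact: lt.
rewrite wvu; split.
  rewrite weyl_dualM; have := alt_root i j k.+1.
  case: alt_coord x0 y0 => -[]// x []// y _ _ ->.
  rewrite weyl_dualD !weyl_dualMn; case: vi vj => vi _ [vj _].
  by apply: nat_spanD; exact: nat_spanMn.
rewrite weyl_valM; have := alt_coroot i j k.+1.
case: alt_coord x1 y1 => -[]// x []// y _ _ ->.
rewrite weyl_valD !weyl_valMz; case: vi vj => _ vi [_ vj].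
by apply: nat_spanD; exact: nat_spanMn.
Qed.

(** * Signs and coordinates of real roots *)

Lemma weyl_dual_val (w : W) (lam : H') x : (w *^ lam) (w x) = lam x.
Proof. by rewrite weyl_dualE weyl_valK. Qed.

Lemma root_coord (z : I -> R[i]) (c : R[i]) k :
  \sum_i z i *: rt i = c *: rt k -> forall i, z i = c *+ (i == k).
Proof.
move=> zc; pose y i := z i - c *+ (i == k).
have y0 : \sum_i y i *: rt i = 0.
  have -> : \sum_i y i *: rt i =
      \sum_i z i *: rt i - \sum_i (c *+ (i == k)) *: rt i.
    by rewrite -sumrB; apply: eq_bigr => i _; rewrite scalerBl.
  rewrite zc (bigD1 k)//= eqxx mulr1n big1 ?addr0 ?subrr// => i /negPf->.
  by rewrite mulr0n scale0r.
by move=> i; apply/eqP; rewrite -subr_eq0; apply/eqP; exact: root_indep y0 i.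
Qed.

Lemma sum_rootMn (n : I -> nat) :
  \sum_i rt i *+ n i = \sum_i (n i)%:R *: rt i :> H'.
Proof. by apply: eq_bigr => i _; rewrite scaler_nat. Qed.

Lemma pos_opp_eq0 (lam : H') : pos lam -> pos (- lam) -> lam = 0.
Proof.
move=> [n nE] [m mE]; rewrite nE big1// => i _.
have nm0 : \sum_i ((n i + m i)%N%:R : R[i]) *: rt i = 0.
  rewrite -(sum_rootMn (fun i => n i + m i)%N) -[RHS](subrr lam) mE {1}nE.
  by rewrite -big_split /=; apply: eq_bigr => k _; rewrite mulrnDr.
have /eqP := root_indep nm0 i.
by rewrite pnatr_eq0 addn_eq0 => /andP[/eqP-> _].
Qed.

Lemma weyl_root_neq0 (w : W) i : w *^ rt i <> 0.
Proof.
move=> w0; have := weyl_dual_val w (rt i) (crt i).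
by rewrite w0 rt_crt => /esym/eqP; rewrite lfunE pnatr_eq0.
Qed.

Lemma weyl_root_posN (w : W) i : pos (w *^ rt i) -> pos (- (w *^ rt i)) -> False.
Proof. by move=> p n; exact: weyl_root_neq0 (pos_opp_eq0 p n). Qed.

Lemma weyl_dual_muls (w : W) i : (w * s i)%g *^ rt i = - (w *^ rt i).
Proof. by rewrite weyl_dualM weyl_dual_srt weyl_dualN. Qed.

(** Otherwise [length_nondecr_pos], applied to [w * s i], would make the opposite root positive as
    well. *)
Lemma pos_length_lt (w : W) i : pos (w *^ rt i) -> (len w < len (w * s i)%g)%N.
Proof.
move=> wi; rewrite ltnNge; apply/negP => le.
have [|h _] := @length_nondecr_pos (w * s i)%g i.
  by rewrite weyl_mulsK.
by apply: weyl_root_posN wi _; rewrite -weyl_dual_muls.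
Qed.

Lemma neg_length_lt (w : W) i : pos (- (w *^ rt i)) -> (len (w * s i)%g < len w)%N.
Proof.
by rewrite -weyl_dual_muls => /pos_length_lt; rewrite weyl_mulsK.
Qed.

Lemma weyl_root_dichotomy (w : W) i : pos (w *^ rt i) \/ pos (- (w *^ rt i)).
Proof.
have [le|/ltnW le] := leqP (len w) (len (w * s i)%g).
  by left; have [] := length_nondecr_pos le.
right; rewrite -weyl_dual_muls.
by have [] : pos_pair ((w * s i)%g *^ rt i) ((w * s i)%g (crt i))
  by apply: length_nondecr_pos; rewrite weyl_mulsK.
Qed.

(** Equal lengths are excluded by the sign of the root [w *^ rt i], in place of the usual
    determinant argument. *)
Lemma length_muls_cases (w : W) i :
  len (w * s i)%g = (len w).+1 \/ len w = (len (w * s i)%g).+1.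
Proof.
have := len_mulsr w i; have := len_mulsr_ge w i.
have [/pos_length_lt|/neg_length_lt] := weyl_root_dichotomy w i; lia.
Qed.

Lemma weyl_root_int (w : W) i :
  exists z : I -> int, w *^ rt i = \sum_i (z i)%:~R *: rt i.
Proof.
have [[n nE]|[n nE]] := weyl_root_dichotomy w i.
  by exists (fun i => (n i)%:Z); rewrite nE sum_rootMn.
exists (fun i => - (n i)%:Z); rewrite -[LHS]opprK nE sum_rootMn -sumrN.
by apply: eq_bigr => k _; rewrite mulrNz scaleNr.
Qed.

(** Real roots have integral coordinates. Applied to w and to its inverse, this makes both c and 1 /
    c integers. *)
Lemma weyl_root_proportional (w : W) j k (c : R[i]) :
  w *^ rt j = c *: rt k -> c = 1 \/ c = - 1.
Proof.
move=> wjk; have [z zE] := weyl_root_int w j.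
have [y yE] := weyl_root_int (w^-1)%g k.
have zk : (z k)%:~R = c.
  by have := root_coord (etrans (esym zE) wjk) k; rewrite eqxx mulr1n.
have yj : c * (y j)%:~R = 1.
  have : \sum_i (c * (y i)%:~R) *: rt i = 1 *: rt j.
    rewrite scale1r -[RHS](weyl_dualK w) wjk weyl_dualZ yE scaler_sumr.
    by apply: eq_bigr => i _; rewrite scalerA.
  by move/root_coord/(_ j); rewrite eqxx mulr1n.
have /eqP : ((z k * y j)%:~R : R[i]) = 1 by rewrite rmorphM /= zk.
rewrite -[1]/(1%:~R) eqr_int => /eqP zy.
have /eqP : absz (z k * y j) = 1%N by rewrite zy.
rewrite abszM muln_eq1 => /andP[/eqP zk1 _].
have {}zk1 : z k = 1 \/ z k = - 1 by lia.
case: zk1 => zk1.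
  by left; rewrite -zk zk1.
by right; rewrite -zk zk1.
Qed.

(** The last letter of a nonempty reduced word is a right descent, which [pos_length_lt] forbids
    here. *)
Lemma length_pos_eq1 (w : W) : (forall i, pos (w *^ rt i)) -> w = 1%g.
Proof.
move=> wpos; have [t st wt] := reduced_word w.
case/lastP: t => [|t j] in st wt *; first by rewrite wt.
have := pos_length_lt (wpos j); rewrite -st {1}wt wprod_rcons weyl_mulsK.
by rewrite size_rcons => lt; have := len_wprod t; lia.
Qed.

(** * Coroots and reflections of real roots are well defined *)

Lemma conj_s_val (w : W) i x :
  (w * s i * w^-1)%g x = x - (w *^ rt i) x *: w (crt i).
Proof.
by rewrite !weyl_valM weyl_sE weyl_valB weyl_valZ weyl_valKV -weyl_dualE.
Qed.

Lemma conj_s_dual (w : W) i (lam : H') :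
  (w * s i * w^-1)%g *^ lam = lam - lam (w (crt i)) *: (w *^ rt i).
Proof.
apply/lfunP => x; rewrite weyl_dualE !invgM invgK weyl_sV mulgA.
by rewrite conj_s_val lfun_valBZ lfun_subZE mulrC.
Qed.

(** The product [t] of the two reflections attached to [rt j] fixes [rt j] and moves the other
    simple roots by multiples of it. Hence it keeps all simple roots positive and is 1; comparing
    the two reflections at [crt j] gives the claim. *)
Lemma weyl_root_coroot (w : W) i j : w *^ rt i = rt j -> w (crt i) = crt j.
Proof.
move=> wij; pose t : W := (s j * (w * s i * w^-1))%g.
pose d := w (crt i).
have tE k : t *^ rt k = rt k + (rt k d - rt k (crt j)) *: rt j.
  rewrite weyl_dualM conj_s_dual wij weyl_dual_s lfun_subZE rt_crt -/d.
  rewrite -addrA -opprD -scalerDl -scaleNr; congr (_ + _ *: _); ring.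
have t1 : t = 1%g.
  apply: length_pos_eq1 => k; have [<-|kj] := eqVneq j k.
    have -> : t *^ rt j = rt j.
      by rewrite tE -[in rt j d]wij weyl_dual_val !rt_crt subrr scale0r addr0.
    exact: nat_span_gen.
  have [//|[n nE]] := weyl_root_dichotomy t k; exfalso.
  (* The coordinate of [t *^ rt k] along [rt k] is 1, so a negative root would give n k + 1 = 0. *)
  have : \sum_i ((n i)%:R + (i == k)%:R) *: rt i =
         - (rt k d - rt k (crt j)) *: rt j.
    under eq_bigr do rewrite scalerDl.
    rewrite big_split /= -sum_rootMn -nE tE.
    rewrite [X in _ + X](bigD1 k)//= eqxx scale1r big1 ?addr0; last first.
      by move=> i0 /negPf->; rewrite scale0r.
    by rewrite opprD addrAC addNr add0r scaleNr.
  move/root_coord/(_ k)/eqP; rewrite eqxx [k == j]eq_sym (negPf kj) mulr0n.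
  by rewrite -natrD pnatr_eq0 addn1.
have : s j (crt j) = (w * s i * w^-1)%g (crt j).
  congr (fun_of_lfun _ _); congr weyl_val.
  by rewrite -[RHS](weyl_smulK _ j) -/t t1 mulg1.
rewrite weyl_sE conj_s_val wij rt_crt => /addrI/oppr_inj/eqP.
rewrite -subr_eq0 -scalerBr scaler_eq0 pnatr_eq0 /= subr_eq0.
by move/eqP.
Qed.

Lemma weyl_root_coroot2 (u v : W) i j :
  u *^ rt i = v *^ rt j -> u (crt i) = v (crt j).
Proof.
move=> uv; have : (v^-1 * u)%g *^ rt i = rt j.
  by rewrite weyl_dualM uv weyl_dualK.
by move/weyl_root_coroot => <-; rewrite weyl_valM weyl_valKV.
Qed.

Lemma corootE (u : W) i : coroot (u *^ rt i) = u (crt i).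
Proof.
rewrite /coroot; case: xgetP => [c _ [v [j [uv ->]]]|].
  exact/esym/weyl_root_coroot2.
by move/(_ (u (crt i))); case; exists u, i.
Qed.

Lemma reflectionE (u : W) i : reflection (u *^ rt i) = (u * s i * u^-1)%g.
Proof.
rewrite /reflection; case: xgetP => [c _ [v [j [uv ->]]]|].
  apply: weyl_inj => x; apply: etrans (conj_s_val v j x) _.
  apply: etrans _ (esym (conj_s_val u i x)); rewrite -uv.
  by congr (_ - _ *: _); exact/esym/weyl_root_coroot2.
by move/(_ (u * s i * u^-1)%g); case; exists u, i.
Qed.

Lemma pos_real_rootP (al : H') : positive_real_root al ->
  exists (u : W) i, [/\ al = u *^ rt i, pos (u *^ rt i),
    coroot al = u (crt i) & reflection al = (u * s i * u^-1)%g].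
Proof.
move=> [[u [i ->]] al0]; exists u, i; split=> //.
  exact: corootE.
exact: reflectionE.
Qed.

Lemma reflection_invol (al : H') : positive_real_root al ->
  (reflection al * reflection al = 1)%g.
Proof.
by move=> /pos_real_rootP[u [i [_ _ _ ->]]]; rewrite !mulgA mulgVK weyl_mulsK mulgV.
Qed.

Lemma reflection_dual (al lam : H') : positive_real_root al ->
  reflection al *^ lam = lam - lam (coroot al) *: al.
Proof. by move=> /pos_real_rootP[u [i [-> _ -> ->]]]; exact: conj_s_dual. Qed.

Lemma reflection_dual_self (al : H') : positive_real_root al ->
  reflection al *^ al = - al.
Proof.
move=> ral; rewrite reflection_dual//.
have [u [i [-> _ -> _]]] := pos_real_rootP ral.
by rewrite weyl_dual_val rt_crt scaler_nat opprD addNKr.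
Qed.

Lemma coroot_pos (al : H') : positive_real_root al -> nat_span crt (coroot al).
Proof.
move=> /pos_real_rootP[u [i [_ al0 -> _]]].
by have [] := length_nondecr_pos (ltnW (pos_length_lt al0)).
Qed.

(** The common reflection negates [be] and moves it along [al], so the two roots are proportional.
    The factor is then 1 or -1, and positivity excludes -1. *)
Lemma reflection_inj (al be : H') : positive_real_root al ->
  positive_real_root be -> reflection al = reflection be -> al = be.
Proof.
move=> ral rbe e; have := reflection_dual_self rbe; rewrite -e reflection_dual//.
have [u [i [alE al0 _ _]]] := pos_real_rootP ral.
have [v [j [beE be0 _ _]]] := pos_real_rootP rbe.
set k : R[i] := be (coroot al) => bek.
have be_al : be = (k / 2) *: al.
  have e2 : 2 *: be = k *: al.
    by rewrite scaler_nat -[RHS](subKr be) bek opprK.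
  by rewrite mulrC -scalerA -e2 scalerA mulVf ?pnatr_eq0// scale1r.
have : (u^-1 * v)%g *^ rt j = (k / 2) *: rt i.
  by rewrite weyl_dualM -beE be_al weyl_dualZ alE weyl_dualK.
move=> /weyl_root_proportional[] k1; first by rewrite be_al k1 scale1r.
exfalso; apply: (weyl_root_posN be0).
by rewrite -beE be_al k1 scaleN1r opprK alE.
Qed.

(** Since s_k changes only the coordinate along [rt k], all other coordinates must vanish, and a
    root that is a natural multiple of [rt k] equals it. *)
Lemma pos_neg_simple (w : W) j k : pos (w *^ rt j) ->
  pos (- (s k *^ (w *^ rt j))) -> w *^ rt j = rt k.
Proof.
set be := w *^ rt j; move=> [n nE] [m mE].
set c := be (crt k) in mE *.
have : \sum_i ((n i + m i)%N%:R : R[i]) *: rt i = c *: rt k.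
  rewrite -(sum_rootMn (fun i => n i + m i)%N).
  transitivity (be - (s k *^ be)); last by rewrite weyl_dual_s opprB addrC subrK.
  by rewrite mE {1}nE -big_split /=; apply: eq_bigr => i _; rewrite mulrnDr.
move/root_coord => nm.
have n0 i : i != k -> n i = 0%N.
  move=> /negPf ik; have /eqP := nm i; rewrite ik pnatr_eq0 addn_eq0.
  by case/andP => /eqP.
have bek : be = (n k)%:R *: rt k.
  rewrite nE (bigD1 k)//= scaler_nat big1 ?addr0// => i /n0->.
  by rewrite mulr0n.
have [k1|/eqP] := weyl_root_proportional bek; first by rewrite bek k1 scale1r.
by rewrite -subr_eq0 opprK natr1 pnatr_eq0.
Qed.

(** * Strong exchange and its consequences *)

(** Apply the letters of t to [al] from the right. At the letter k that turns the image negative,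
    this image was [rt k] by [pos_neg_simple], so the reflection is a conjugate of [s k] and deletes
    that letter. The word need not be reduced. *)
Lemma strong_exchange (t : seq I) (al : H') : positive_real_root al ->
  pos (- (wprod t *^ al)) ->
  exists t1 k t2, t = t1 ++ k :: t2 /\
    (wprod t * reflection al)%g = wprod (t1 ++ t2).
Proof.
move=> ral; have [u [i [alE al0 _ _]]] := pos_real_rootP ral.
elim: t => [|k t IH].
  by rewrite weyl_dual1 alE => /(weyl_root_posN al0).
have e : wprod t *^ al = (wprod t * u)%g *^ rt i.
  rewrite alE; exact/esym/weyl_dualM.
have [be0|be0] := weyl_root_dichotomy (wprod t * u)%g i; last first.
  move=> _; have [|t1 [l [t2 [-> tE]]]] := IH; first by rewrite e.
  by exists (k :: t1), l, t2; split; [| rewrite /= -mulgA tE].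
rewrite [wprod _]/= weyl_dualM e => /(pos_neg_simple be0); rewrite -e => tk.
exists [::], k, t; split; first by [].
have -> : al = ((wprod t)^-1)%g *^ rt k by rewrite -tk weyl_dualK.
by rewrite reflectionE invgK !mulgA /= mulgK weyl_sK mul1g.
Qed.

(** A reduced word of [w * reflection al] sends [al] to a negative root, so exchange deletes one of
    its letters and leaves w. *)
Lemma reflection_length_gt (w : W) (al : H') : positive_real_root al ->
  pos (w *^ al) -> (len w < len (w * reflection al)%g)%N.
Proof.
move=> ral wal; have [t st wt] := reduced_word (w * reflection al)%g.
have [|t1 [k [t2 [tE]]]] := @strong_exchange t al ral.
  by rewrite -wt weyl_dualM reflection_dual_self// weyl_dualN opprK.
rewrite -wt -mulgA reflection_invol// mulg1 => wt'.
rewrite -st tE wt'.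
by rewrite (leq_ltn_trans (len_wprod _))// !size_cat /= addnS.
Qed.

Lemma length_smul_cases (w : W) i :
  len (s i * w)%g = (len w).+1 \/ len w = (len (s i * w)%g).+1.
Proof.
have := length_muls_cases (w^-1)%g i; rewrite -(weyl_sV i) -invgM !lenV.
by rewrite weyl_sV.
Qed.

(** Put i before a reduced word of s_i w, where w = v s_alpha; exchange deletes a letter of this
    word of w and leaves v. If the letter is not the initial i, the word of v still begins with i
    and [s i * v] is shorter than v, a contradiction. *)
Lemma cover_smul_descent (v : W) i (al : H') : strong_cover v al ->
  (len v < len (s i * v)%g)%N ->
  (len (s i * (v * reflection al))%g < len (v * reflection al)%g)%N ->
  (v * reflection al)%g = (s i * v)%g.
Proof.
move=> [ral]; set w := (v * _)%g => lw lv lsw.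
have vw : v = (w * reflection al)%g by rewrite -mulgA reflection_invol// mulg1.
have lsw' : len (s i * w)%g = len v by case: (length_smul_cases w i); lia.
have [t st tE] := reduced_word (s i * w)%g.
have wt : w = wprod (i :: t) by rewrite /= -tE weyl_smulK.
have [|t1 [k [t2 [tE' vE]]]] := @strong_exchange (i :: t) al ral.
  have [u [j [alE _ _ _]]] := pos_real_rootP ral.
  have [wal|] := weyl_root_dichotomy (w * u)%g j; last first.
    by rewrite weyl_dualM -alE -wt.
  have := @reflection_length_gt w al ral; rewrite -vw lw => h.
  exfalso; suff : ((len v).+1 < len v)%N by lia.
  by apply: h; rewrite alE -weyl_dualM.
rewrite -wt -vw in vE.
case: t1 => [|l t1] /= in tE' vE.
  by case: tE' => _ <- in vE; rewrite vE -tE weyl_smulK.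
case: tE' vE => <- tE' vE; exfalso.
have : (len (s i * v)%g <= size (t1 ++ t2))%N.
  by rewrite vE weyl_smulK len_wprod.
move: (congr1 size tE'); rewrite !size_cat /=; lia.
Qed.

(** * The operators as finite sums over covers *)

Lemma finite_length n : finite_set [set w : W | len w = n].
Proof.
apply: (@sub_finite_set _ _ ((fun t : n.-tuple I => wprod t) @` setT)).
  move=> w /= wn; have [t st ->] := reduced_word w.
  have sz : size t == n by rewrite st wn.
  by exists (Tuple sz).
by apply: finite_image; exact: finite_finset.
Qed.

Lemma reflection_mul_inj (v : W) (al be : H') : strong_cover v al ->
  strong_cover v be -> (v * reflection al = v * reflection be)%g -> al = be.
Proof. by move=> [ral _] [rbe _] /mulgI; exact: reflection_inj. Qed.

(** This keeps the sum in [up] from collapsing to its default value 0. Covers inject into the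
    elements of length [len v] + 1, of which there are finitely many because I is finite. *)
Lemma finite_strong_cover (v : W) : finite_set [set al : H' | strong_cover v al].
Proof.
set C := [set _ | _]; pose f (al : H') := (v * reflection al)%g.
have /card_eqPle[_ Cf] : (f @` C #= C)%card.
  apply: inj_card_eq => al be; rewrite !inE; exact: reflection_mul_inj.
apply: card_le_finite Cf _; apply: sub_finite_set (finite_length (len v).+1).
by move=> _ [al [_ lal] <-].
Qed.

Definition covers (v : W) : seq H' := fset_set [set al : H' | strong_cover v al].

Lemma mem_covers (v : W) (al : H') : al \in covers v <-> strong_cover v al.
Proof.
rewrite /covers in_fset_set; last exact: finite_strong_cover.
by rewrite inE.
Qed.

(** The two ends of a strong cover determine its root, so the sum has a single term. *)
Lemma strong_multE Lam (v : W) (al : H') : strong_cover v al ->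
  strong_mult Lam v (v * reflection al)%g = wt_mult Lam al.
Proof.
move=> cal; rewrite /strong_mult.
rewrite (_ : [set _ | _] = [set al]); first exact: fsbig_set1.
apply/seteqP; split=> [be [cbe e]|be ->]; last by split.
exact/esym/(reflection_mul_inj cal cbe).
Qed.

Lemma up_strong Lam (v : W) :
  Defs.up (strong_graph Lam) << v >> =
  \sum_(al <- covers v) (<< (v * reflection al)%g >> : {freeg W}) *+ wt_mult Lam al.
Proof.
rewrite upU; set C := [set al : H' | strong_cover v al].
pose f (al : H') : W := (v * reflection al)%g.
rewrite -(@fsbig_widen _ _ _ _ (f @` C)); [|by []|].
  rewrite fsbig_image; last first.
    by move=> al be; rewrite !inE; exact: reflection_mul_inj.
  rewrite fsbig_finite; last exact: finite_strong_cover.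
  apply: eq_big_seq => al /mem_covers cal.
  by congr (_ *+ _); exact: strong_multE.
move=> w [_ Cw] /=; rewrite [strong_mult _ _ _](_ : _ = 0%N) ?mulr0n//.
by apply: fsbig1 => al [cal wE]; exfalso; apply: Cw; exists al.
Qed.

Lemma down_weak varpi (k : I -> nat) (w : W) : fundamental_weights varpi ->
  Defs.down (weak_graph varpi (\sum_i crt i *+ k i)) << w >> =
  \sum_(i | (len (s i * w)%g < len w)%N) (<< (s i * w)%g >> : {freeg W}) *+ k i.
Proof.
move=> fw; rewrite downU.
pose r : seq W := undup [seq (s i * w)%g | i : I].
have sV (v : W) i : (w == s i * v)%g = (v == s i * w)%g.
  by apply/eqP/eqP => ->; rewrite weyl_smulK.
have multE v : mult (weak_graph varpi (\sum_i crt i *+ k i)) v w =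
    (\sum_(i | (len (s i * w)%g < len w)%N && (v == s i * w)%g) k i)%N.
  rewrite /= /weak_mult; apply: eq_big => [i|i _].
    rewrite sV andbC [RHS]andbC; case: eqP => //= ->.
    rewrite /weak_cover weyl_smulK; have := length_smul_cases w i.
    by move=> h; apply/eqP/idP; lia.
  exact: fundamental_weights_coord.
rewrite (fsbigE r) ?undup_uniq//; last first.
  move=> v _ vr; rewrite multE big_pred0 ?mulr0n// => i; apply/negbTE/negP.
  case/andP => _ /eqP vE; case/negP: vr; rewrite mem_undup vE.
  by apply/mapP; exists i; rewrite ?mem_enum.
transitivity (\sum_(v <- r) \sum_(i | (len (s i * w)%g < len w)%N && (v == s i * w)%g)
    (<< v >> : {freeg W}) *+ k i).
  by apply: eq_big => [v|v _]; [rewrite in_setT | rewrite multE -sumrMnr].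
rewrite (exchange_big_dep (fun i => (len (s i * w)%g < len w)%N)) /=; last first.
  by move=> v i _ /andP[].
apply: eq_bigr => i lt; rewrite lt /=.
rewrite -big_filter (_ : [seq _ <- r | _] = [:: (s i * w)%g]) ?big_seq1//.
rewrite (eq_filter (a2 := pred1 (s i * w)%g))// filter_pred1_uniq ?undup_uniq//.
by rewrite mem_undup; apply/mapP; exists i; rewrite ?mem_enum.
Qed.

(** * Strong covers and left multiplication by a simple reflection *)

(** A left weak cover is a strong cover: conjugation by v moves s_i to the right of v. *)
Lemma inv_root_cover (v : W) i : (len v < len (s i * v)%g)%N ->
  [/\ strong_cover v ((v^-1)%g *^ rt i),
      (v * reflection ((v^-1)%g *^ rt i) = s i * v)%g &
      coroot ((v^-1)%g *^ rt i) = (v^-1)%g (crt i)].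
Proof.
move=> lt; have rE : (v * reflection ((v^-1)%g *^ rt i) = s i * v)%g.
  by rewrite reflectionE invgK !mulgA mulgV mul1g.
split; [split; [split|]|exact: rE|exact: corootE].
- by exists (v^-1)%g, i.
- have [] : pos_pair ((v^-1)%g *^ rt i) ((v^-1)%g (crt i)); last by [].
  apply: length_nondecr_pos; rewrite -(weyl_sV i) -invgM !lenV.
  exact: ltnW.
- by rewrite rE; have [h|h] := length_smul_cases v i; [exact: h|exfalso; lia].
Qed.

Lemma cover_ascent (v : W) i (al : H') : strong_cover v al ->
  (len v < len (s i * v)%g)%N ->
  (len (s i * (v * reflection al))%g < len (v * reflection al)%g)%N ->
  al = (v^-1)%g *^ rt i.
Proof.
move=> cal lt lt'; have e := cover_smul_descent cal lt lt'.
have [cbe rbe _] := inv_root_cover lt.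
exact: (reflection_mul_inj cal cbe (etrans e (esym rbe))).
Qed.

Lemma covers_ascent (v : W) i : (len v < len (s i * v)%g)%N ->
  perm_eq [seq al <- covers v |
            (len (s i * (v * reflection al))%g < len (v * reflection al)%g)%N]
          [:: (v^-1)%g *^ rt i].
Proof.
move=> lt; have [cbe rbe _] := inv_root_cover lt.
apply: uniq_perm; [exact/filter_uniq/fset_uniq|by []|] => al.
rewrite mem_filter mem_seq1; apply/andP/eqP => [[lt' /mem_covers cal]|->].
  exact: cover_ascent.
split; last exact/mem_covers.
by rewrite rbe weyl_smulK.
Qed.

(** Left multiplication by [s i] matches the covers of [s i * v] other than v with the covers of v
    that [s i] shortens, and it keeps the root. These are the terms that cancel between DU and
    UD. *)
Lemma covers_descent (v : W) i : (len (s i * v)%g < len v)%N ->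
  perm_eq (covers (s i * v)%g)
    (((s i * v)^-1)%g *^ rt i :: [seq al <- covers v |
      (len (s i * (v * reflection al))%g < len (v * reflection al)%g)%N]).
Proof.
move=> lt; pose v' : W := (s i * v)%g.
have vE : v = (s i * v')%g by rewrite weyl_smulK.
have lt' : (len v' < len (s i * v')%g)%N by rewrite -vE.
have lv : len v = (len v').+1 by rewrite /v'; case: (length_smul_cases v i); lia.
have [cbe rbe _] := inv_root_cover lt'.
have sE al : (s i * (v * reflection al) = v' * reflection al)%g by rewrite mulgA.
apply: uniq_perm; [exact: fset_uniq| |] => [|al].
  rewrite cons_uniq; apply/andP; split; last exact/filter_uniq/fset_uniq.
  rewrite mem_filter; apply/negP => /andP[_ /mem_covers[_]].
  rewrite -/v' {1}vE -mulgA rbe weyl_smulK; lia.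
rewrite inE mem_filter; apply/idP/orP => [/mem_covers cal|[/eqP->|/andP[]]].
(* A cover of v' that [s i] shortens can only be v itself, which gives the exceptional root; any
   other cover is lengthened. *)
- have [lt''|le] := ltnP (len (v * reflection al)%g) (len (v' * reflection al)%g).
    left; apply/eqP; apply: cover_ascent cal lt' _.
    by rewrite -/v' [in ltnLHS]mulgA -vE.
  right; rewrite sE; have [ral lal] := cal.
  have := length_smul_cases (v * reflection al)%g i; rewrite sE -/v' in lal *.
  move=> h; apply/andP; split; first by lia.
  by apply/mem_covers; split; [exact: ral|lia].
- exact/mem_covers.
- rewrite sE => h /mem_covers[ral lal]; apply/mem_covers; split; first exact: ral.
  have := length_smul_cases (v * reflection al)%g i; rewrite sE -/v'; lia.
Qed.

(** * The commutator, one simple reflection at a time *)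

(** The coroot is a natural combination of simple coroots, on which [Lam] takes natural values, so
    [nat_of_complex] loses nothing. *)
Lemma wt_multE (Lam : H') (al : H') : dominant_integral Lam ->
  positive_real_root al -> (wt_mult Lam al)%:R = pairing (coroot al) Lam.
Proof.
move=> dom /coroot_pos[n ->]; have /choice[m mE] := dom.
have -> : pairing (\sum_i crt i *+ n i) Lam = (\sum_i m i * n i)%N%:R.
  rewrite /pairing linear_sum natr_sum; apply: eq_bigr => i _.
  by rewrite raddfMn natrM mulr_natr /= -mE.
by rewrite nat_of_complexE.
Qed.

(** This is the contribution of the letter i to DU - UD at v, with the weight k_i left out. *)
Lemma commutator_simple (Lam : H') (v : W) i : dominant_integral Lam ->
  exists2 z : int, z%:~R = pairing ((v^-1)%g (crt i)) Lam &
    \sum_(al <- covers v |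
        (len (s i * (v * reflection al))%g < len (v * reflection al)%g)%N)
      (<< (s i * (v * reflection al))%g >> : {freeg W}) *+ wt_mult Lam al
    - (if (len (s i * v)%g < len v)%N then
         \sum_(al <- covers (s i * v)%g)
           (<< (s i * v * reflection al)%g >> : {freeg W}) *+ wt_mult Lam al
       else 0)
    = << v >> *~ z.
Proof.
move=> dom; case: ifPn => [lt|]; last first.
  rewrite -leqNgt => le.
  have {le}lt : (len v < len (s i * v)%g)%N by case: (length_smul_cases v i); lia.
  have [[rbe _] vbe cbe] := inv_root_cover lt.
  exists (wt_mult Lam ((v^-1)%g *^ rt i))%:Z.
    rewrite -cbe; exact: wt_multE.
  rewrite -big_filter (perm_big _ (covers_ascent lt)) big_seq1 subr0.
  by rewrite vbe weyl_smulK.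
pose v' : W := (s i * v)%g.
have vE : v = (s i * v')%g by rewrite weyl_smulK.
have lt' : (len v' < len (s i * v')%g)%N by rewrite -vE.
have [[rbe _] vbe cbe] := inv_root_cover lt'.
(* The minus sign agrees with the pairing because the inverses of v' and v send [crt i] to opposite
   elements. *)
exists (- (wt_mult Lam ((v'^-1)%g *^ rt i))%:Z).
  rewrite mulrNz [_%:~R](wt_multE dom rbe) cbe /v' invgM weyl_sV weyl_valM.
  by rewrite weyl_s_crt weyl_valN /pairing linearN opprK.
rewrite (perm_big _ (covers_descent lt)) big_cons big_filter -/v' vbe -vE.
rewrite opprD addrCA mulrNz.
have -> : forall a b c : {freeg W}, b = c -> a + (b - c) = a.
- by move=> a b c ->; rewrite subrr addr0.
- by [].
- by apply: eq_bigr => al _; rewrite mulgA.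
Qed.

(** * Central elements and the duality *)

Lemma weyl_fix (K : H) : (forall i, rt i K = 0) -> forall w : W, w K = K.
Proof.
move=> K0 w; have [t _ ->] := reduced_word w.
elim: t => [|i t IH]; first exact: weyl_val1.
by rewrite [wprod _]/= weyl_valM IH weyl_sE K0 scale0r subr0.
Qed.

(** The bracket of K with e_i is alpha_i(K) e_i, and e_i is nonzero because its bracket with f_i is
    the nonzero coroot. *)
Lemma central_root_eq0 (g : kac_moody_algebra rz) (K : H) :
  lie_center (km_h g K) -> forall i, rt i K = 0.
Proof.
move=> cK i; have := km_he g K i; rewrite cK => /esym/eqP.
rewrite scaler_eq0 => /orP[/eqP//|/eqP e0]; exfalso.
have := km_ef g i i; rewrite eqxx e0.
have -> : bracket 0 (km_f g i) = 0.
  have := @bracket_linearl _ g (km_f g i) (-1) 0 0.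
  by rewrite scaler0 addr0 scaleN1r addNr.
rewrite -(linear0 (km_h g)) => /km_h_inj c0.
have := rt_crt i; rewrite -c0 linear0 => /esym/eqP.
by rewrite pnatr_eq0.
Qed.

Lemma strong_weak_commutator (varpi : I -> H') (Lam : H') (k : I -> nat) (r : int) :
    fundamental_weights varpi -> dominant_integral Lam ->
    (forall i, rt i (\sum_i crt i *+ k i) = 0) ->
    r%:~R = pairing (\sum_i crt i *+ k i) Lam ->
  dual_graded_graphs (strong_graph Lam) (weak_graph varpi (\sum_i crt i *+ k i)) r.
Proof.
move=> fw dom K0 rE; apply: dual_graded_graphsU => v.
have /choice[z zP] : forall i, exists z : int, _ := fun i =>
  let: ex_intro2 z p q := commutator_simple v i dom in ex_intro _ z (conj p q).
have -> : r = \sum_i z i * (k i)%:Z.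
  apply/eqP; rewrite -(eqr_int R[i]) rE rmorph_sum /=.
  (* As W fixes K, it may be replaced by its image under the inverse of v, whose pairing with [Lam]
     expands into the [z i]; so the sum does not depend on v. *)
  rewrite -{1}(weyl_fix K0 (v^-1)%g) /pairing !linear_sum; apply/eqP.
  apply: eq_bigr => i _; have [zE _] := zP i.
  by rewrite intrM zE !raddfMn /= -mulr_natr.
rewrite up_strong down_weak// mulrz_sumr.
transitivity (\sum_i (<< v >> *~ z i *+ k i : {freeg W})); last first.
  by apply: eq_bigr => i _; rewrite mulrzA.
under [in RHS]eq_bigr do rewrite -(zP _).2 mulrnBl.
rewrite sumrB; congr (_ - _).
  rewrite raddf_sum /=.
  under eq_bigr do rewrite raddfMn /= down_weak// -sumrMnl.
  rewrite (exchange_big_dep xpredT) //=; apply: eq_bigr => i _.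
  by rewrite -sumrMnl; apply: eq_bigr => al _; rewrite -!mulrnA mulnC.
rewrite raddf_sum big_mkcond /=; apply: eq_bigr => i _.
case: ifP => _; last by rewrite mul0rn.
by rewrite raddfMn /= up_strong.
Qed.

End Weyl.

Theorem theorem2p3 (R : realType) (I : finType) (A : gen_cartan_matrix I)
    (rz : realization R A) (g : kac_moody_algebra rz)
    (varpi : I -> 'Hom(cartan rz, R[i]^o)) (hvarpi : fundamental_weights varpi)
    (Lam : 'Hom(cartan rz, R[i]^o)) (hLam : dominant_integral Lam)
    (K : cartan rz) (hK : positive_center g K) :
  exists r : nat, r%:R = pairing K Lam /\
    dual_graded_graphs (strong_graph Lam) (weak_graph varpi K) r.
Proof.
have [cK [k KE]] := hK; have /choice[n nE] := hLam.
have rE : ((\sum_i n i * k i)%N)%:R = pairing K Lam.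
  rewrite KE /pairing linear_sum natr_sum; apply: eq_bigr => i _.
  by rewrite raddfMn natrM mulr_natr /= -nE.
exists (\sum_i n i * k i)%N; split; first exact: rE.
rewrite KE in cK rE *; apply: strong_weak_commutator => //.
exact: central_root_eq0 cK.
Qed.
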